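(* Let $\mathcal G$ be a fixed, connected, undirected graph on $N\ge 2$ nodes with Laplacian $L=L^\top$, whose eigenvalues are $0=\lambda_1(L)<\lambda_2(L)\le\cdots\le\lambda_N(L)$. Let $\mathbf E_1,\dots,\mathbf E_N$ be the selector matrices of a block partition of $\mathbb R^d$, let $\mathbf P_i=\mathbf E_i\mathbf E_i^\top$ (so $\sum_{i=1}^N\mathbf P_i=I_d$) and $\mathbf P=\mathrm{blkdiag}(\mathbf P_1,\dots,\mathbf P_N)\in\mathbb R^{Nd\times Nd}$. Define $W:=I_N-\alpha L$ and $\mathbf A_{\mathrm{sys}}:=W\otimes I_d-\mathbf P$. If $0<\alpha<1/\lambda_N(L)$, then $\|\mathbf A_{\mathrm{sys}}\|_2<1$. Consequently, with $\sigma:=\|\mathbf A_{\mathrm{sys}}\|_2\in[0,1)$, $$\|\mathbf A_{\mathrm{sys}}\mathbf x\|_2\le\sigma\|\mathbf x\|_2\qquad\text{for all }\mathbf x\in\mathbb R^{Nd}.$$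
   Context: Graphs are simple and unweighted; $L$ is the combinatorial graph Laplacian (degree matrix minus adjacency matrix). $\|\cdot\|_2$ is the Euclidean norm on vectors and the induced spectral norm on matrices. Selector matrices: $d=\sum_{i=1}^N d_i$, vectors $u\in\mathbb R^d$ are partitioned as $u=[u_1^\top,\dots,u_N^\top]^\top$ with $u_i\in\mathbb R^{d_i}$, and $\mathbf E_i\in\{0,1\}^{d\times d_i}$ is the block-column of $I_d$ corresponding to the coordinates of $u_i$. Hence $\mathbf E_i^\top\mathbf E_i=I_{d_i}$, $\mathbf E_i^\top\mathbf E_j=0$ for $i\ne j$, and $\sum_i\mathbf E_i\mathbf E_i^\top=I_d$. $\otimes$ is the Kronecker product; vectors in $\mathbb R^{Nd}$ are stacks of $N$ vectors in $\mathbb R^d$. *)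

(* Defs.v *)
From HB Require Import structures.
From mathcomp Require Import all_boot all_order all_algebra.
From mathcomp Require Import mxtens.
From mathcomp Require Import all_classical all_reals.

Set Implicit Arguments.
Unset Strict Implicit.
Unset Printing Implicit Defensive.

Import Order.TTheory GRing.Theory Num.Theory.

Local Open Scope ring_scope.

(* A simple graph on N nodes is given by its adjacency relation on 'I_N. *)
Definition simple_graph (N : nat) (e : rel 'I_N) : Prop :=
  symmetric e /\ irreflexive e.

Definition connected_graph (N : nat) (e : rel 'I_N) : Prop :=
  forall i j : 'I_N, connect e i j.

Definition adjacency_mx (R : realType) (N : nat) (e : rel 'I_N) : 'M[R]_N :=
  \matrix_(i < N, j < N) (e i j)%:R.

Definition degree_mx (R : realType) (N : nat) (e : rel 'I_N) : 'M[R]_N :=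
  diag_mx (\row_(i < N) #|[set j | e i j]|%:R).

Definition laplacian (R : realType) (N : nat) (e : rel 'I_N) : 'M[R]_N :=
  degree_mx R e - adjacency_mx R e.

(* lam lists the eigenvalues of A in nondecreasing order, with multiplicity;
   with 0-based indexing, lambda_k(A) is lam`_k.-1. *)
Definition ordered_spectrum (R : realType) (n : nat) (A : 'M[R]_n)
    (lam : n.-tuple R) : Prop :=
  sorted <=%R lam /\ char_poly A = \prod_(a <- lam) ('X - a%:P).

(* The topological libraries normalize 'cV[R]_n with the max norm, whence
   these definitions of the Euclidean norm and of the norm it induces. *)
Definition norm2 (R : realType) (n : nat) (x : 'cV[R]_n) : R :=
  Num.sqrt (\sum_(i < n) x i ord0 ^+ 2).

(* The set below is nonempty and bounded, so this is a genuine supremum. *)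
Definition specnorm (R : realType) (m n : nat) (A : 'M[R]_(m, n)) : R :=
  sup [set norm2 (A *m x) | x in [set x : 'cV[R]_n | norm2 x <= 1]]%classic.

Section BlockPartition.
Variables (R : realType) (N : nat) (p : 'I_N -> nat).

Local Notation d := (\sum_(i < N) p i)%N.

Definition selector (i : 'I_N) : 'M[R]_(d, p i) := submxrow 1%:M i.

Definition selproj (i : 'I_N) : 'M[R]_d := selector i *m (selector i)^T.

End BlockPartition.

Lemma blkdiag_dim (N d : nat) : (\sum_(i < N) d = N * d)%N.
Proof. by rewrite sum_nat_const card_ord. Qed.

(* The cast only identifies the index types 'I_(\sum_(i < N) d) and
   'I_(N * d); it keeps the numerical value of every index. *)
Definition blkdiag (R : realType) (N d : nat) (B : 'I_N -> 'M[R]_d) :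
    'M[R]_(N * d) :=
  castmx (blkdiag_dim N d, blkdiag_dim N d) (\mxdiag_(i < N) B i).

(* A *t B is the Kronecker product. *)
Definition A_sys (R : realType) (N : nat) (e : rel 'I_N) (p : 'I_N -> nat)
    (alpha : R) : 'M[R]_(N * (\sum_(i < N) p i)) :=
  let W : 'M[R]_N := 1%:M - alpha *: laplacian R e in
  W *t 1%:M - blkdiag (selproj R p).

(* Main.v *)
(** The quadratic form of A := A_sys lies strictly between - |x|^2 and |x|^2 for
    x <> 0. Indeed <x, A x> is |x|^2 - alpha <x, (L (x) I) x> - <x, P x>, where
    0 <= P <= I and 0 <= alpha (L (x) I) < I. The two subtracted terms cannot
    both vanish: the first vanishes only if all agents hold the same vector v,
    and then the second is |v|^2 because the P_i sum to the identity.
    Since A is symmetric, I - A^2 is then positive definite, hence coercive,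
    which bounds the norm of A away from 1. *)

Require Import Defs.
From HB Require Import structures.
From mathcomp Require Import all_boot all_order all_algebra.
From mathcomp Require Import mxtens ring lra.
From mathcomp Require Import all_classical all_reals.

Set Implicit Arguments.
Unset Strict Implicit.
Unset Printing Implicit Defensive.

Import Order.TTheory GRing.Theory Num.Theory.

Local Open Scope ring_scope.

(** * Euclidean inner product and norm *)

Section DotProduct.
Variables (R : realType).

Definition dotv n (x y : 'cV[R]_n) : R := (x^T *m y) ord0 ord0.

Lemma dotvE n (x y : 'cV[R]_n) : dotv x y = \sum_i x i ord0 * y i ord0.
Proof. by rewrite /dotv mxE; apply: eq_bigr => i _; rewrite mxE. Qed.

Lemma dotvC n (x y : 'cV[R]_n) : dotv x y = dotv y x.
Proof. by rewrite !dotvE; apply: eq_bigr => i _; rewrite mulrC. Qed.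

Lemma dotvDr n (x y z : 'cV[R]_n) : dotv x (y + z) = dotv x y + dotv x z.
Proof. by rewrite /dotv mulmxDr mxE. Qed.

Lemma dotvDl n (x y z : 'cV[R]_n) : dotv (x + y) z = dotv x z + dotv y z.
Proof. by rewrite dotvC dotvDr !(dotvC z). Qed.

Lemma dotvZr n a (x y : 'cV[R]_n) : dotv x (a *: y) = a * dotv x y.
Proof. by rewrite /dotv -scalemxAr mxE. Qed.

Lemma dotvZl n a (x y : 'cV[R]_n) : dotv (a *: x) y = a * dotv x y.
Proof. by rewrite dotvC dotvZr dotvC. Qed.

Lemma dotvNr n (x y : 'cV[R]_n) : dotv x (- y) = - dotv x y.
Proof. by rewrite -scaleN1r dotvZr mulN1r. Qed.

Lemma dotvNl n (x y : 'cV[R]_n) : dotv (- x) y = - dotv x y.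
Proof. by rewrite dotvC dotvNr dotvC. Qed.

Lemma dotv0r n (x : 'cV[R]_n) : dotv x 0 = 0.
Proof. by rewrite /dotv mulmx0 mxE. Qed.

Definition dotvlin := (dotvDr, dotvDl, dotvZr, dotvZl, dotvNr, dotvNl).

Lemma dotv_mulmxl m n (A : 'M[R]_(m, n)) (x : 'cV[R]_n) (y : 'cV[R]_m) :
  dotv (A *m x) y = dotv x (A^T *m y).
Proof. by rewrite /dotv trmx_mul mulmxA. Qed.

Lemma dotv_sumr n (I : finType) (x : 'cV[R]_n) (F : I -> 'cV[R]_n) :
  dotv x (\sum_i F i) = \sum_i dotv x (F i).
Proof. by rewrite /dotv mulmx_sumr summxE. Qed.

Lemma dotvv_ge0 n (x : 'cV[R]_n) : 0 <= dotv x x.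
Proof. by rewrite dotvE sumr_ge0 // => i _; rewrite -expr2 sqr_ge0. Qed.

Lemma dotvv_eq0 n (x : 'cV[R]_n) : dotv x x = 0 -> x = 0.
Proof.
rewrite dotvE => /eqP; rewrite psumr_eq0 => [/allP x0|i _]; last first.
  by rewrite -expr2 sqr_ge0.
apply/matrixP => i j; rewrite ord1 mxE.
by have := x0 i (mem_index_enum i); rewrite -expr2 sqrf_eq0 => /eqP.
Qed.

Lemma dotvv_gt0 n (x : 'cV[R]_n) : x != 0 -> 0 < dotv x x.
Proof.
by move=> x0; rewrite lt_def dotvv_ge0 andbT; apply: contra_neq x0; apply: dotvv_eq0.
Qed.

Lemma norm2E n (x : 'cV[R]_n) : norm2 x = Num.sqrt (dotv x x).
Proof. by rewrite dotvE /norm2; congr Num.sqrt; apply: eq_bigr. Qed.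

Lemma norm2_ge0 n (x : 'cV[R]_n) : 0 <= norm2 x.
Proof. exact: sqrtr_ge0. Qed.

Lemma norm2Z n a (x : 'cV[R]_n) : norm2 (a *: x) = `|a| * norm2 x.
Proof.
by rewrite !norm2E !dotvlin mulrA -expr2 sqrtrM ?sqr_ge0 // sqrtr_sqr.
Qed.

Lemma norm2_eq0 n (x : 'cV[R]_n) : norm2 x = 0 -> x = 0.
Proof.
rewrite norm2E => /eqP; rewrite sqrtr_eq0 => x0.
by apply: dotvv_eq0; apply/eqP; rewrite eq_le x0 dotvv_ge0.
Qed.

End DotProduct.

(** * Bounds on quadratic forms: coercivity, Rayleigh quotients, contraction *)

Section Coercivity.
Variables (R : realType) (n : nat).
Implicit Types (A B M : 'M[R]_n) (x : 'cV[R]_n).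

Lemma form_upper_bound B :
  exists2 K, 0 < K & forall x, dotv x (B *m x) <= K * dotv x x.
Proof.
pose K := \sum_i \sum_j `|B i j|.
have K0 : 0 <= K by apply: sumr_ge0 => i _; apply: sumr_ge0.
(* The entry sum [K] vanishes for [B = 0]; adding 1 makes the bound invertible. *)
exists (1 + K); first lra.
move=> x; apply: (@le_trans _ _ (K * dotv x x)); last first.
  have := dotvv_ge0 x; nra.
rewrite {1}dotvE mulr_suml; apply: ler_sum => i _.
rewrite mxE mulr_sumr mulr_suml; apply: ler_sum => j _.
have sq k : x k ord0 ^+ 2 <= dotv x x.
  rewrite dotvE (bigD1 k) //= -expr2 lerDl sumr_ge0 // => l _.
  by rewrite -expr2 sqr_ge0.
(* The squares of [x_i + x_j] and [x_i - x_j] give [2 |x_i x_j| <= x_i^2 + x_j^2]. *)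
have xij : `|x i ord0 * x j ord0| <= dotv x x.
  rewrite ler_norml; have := sq i; have := sq j.
  have := sqr_ge0 (x i ord0 + x j ord0); have := sqr_ge0 (x i ord0 - x j ord0).
  move=> *; nra.
rewrite mulrCA (le_trans (ler_norm _)) // normrM.
by apply: ler_wpM2l.
Qed.

(* The form of [M] is evaluated at [x - t M^-1 x], with [1 / t] an upper bound
   of the form of [M^-1]. *)
Lemma psd_unitmx_coercive M :
  M^T = M -> M \in unitmx -> (forall x, 0 <= dotv x (M *m x)) ->
  exists2 c, 0 < c & forall x, c * dotv x x <= dotv x (M *m x).
Proof.
move=> Msym Munit Mpsd; have [K K0 HK] := form_upper_bound (invmx M).
exists K^-1; rewrite ?invr_gt0 // => x.
have := Mpsd (x - K^-1 *: (invmx M *m x)); have := HK x.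
rewrite mulmxBr -scalemxAr mulKVmx //.
rewrite !dotvlin [dotv (invmx M *m x) (M *m x)]dotvC dotv_mulmxl Msym mulKVmx //.
rewrite [dotv (invmx M *m x) x]dotvC.
set a := dotv x (invmx M *m x); set b := dotv x x; set q := dotv _ _.
move=> aKb qge.
(* With [t = K^-1], positivity reads [q - 2 t b + t^2 a >= 0], and [t a <= b] turns this into
   [q >= t b]. *)
have : K^-1 * a <= b by rewrite ler_pdivrMl.
have : 0 < K^-1 by rewrite invr_gt0.
nra.
Qed.

(** A kernel vector would annihilate the form, so definiteness gives invertibility. *)
Lemma posdef_coercive M :
  M^T = M -> (forall x, x != 0 -> 0 < dotv x (M *m x)) ->
  exists2 c, 0 < c & forall x, c * dotv x x <= dotv x (M *m x).
Proof.
move=> Msym Mpos; apply: psd_unitmx_coercive => //; last first.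
  move=> x; have [->|x0] := eqVneq x 0; first by rewrite mulmx0 dotv0r.
  exact/ltW/Mpos.
rewrite unitmxE unitfE; apply/det0P => -[v v0 vM].
have := Mpos v^T; rewrite trmx_eq0 v0 => /(_ isT).
by rewrite -[M]Msym -trmx_mul vM trmx0 dotv0r ltxx.
Qed.

(* The least upper bound [m] of the Rayleigh quotient is an eigenvalue,
   since otherwise [m - B] would be coercive and [m] could be decreased. *)
Lemma rayleigh_le B (l : R) :
  B^T = B -> (forall a, root (char_poly B) a -> a <= l) ->
  forall x, dotv x (B *m x) <= l * dotv x x.
Proof.
move=> Bsym Bl x; rewrite leNgt; apply/negP => xl.
(* A nonzero vector is what bounds [S] below, so that its infimum is meaningful. *)
have x0 : x != 0 by apply: contraTneq xl => ->; rewrite mulmx0 !dotv0r mulr0 ltxx.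
pose S := [set t : R | forall y, dotv y (B *m y) <= t * dotv y y]%classic.
have lbS y : y != 0 -> lbound S (dotv y (B *m y) / dotv y y).
  by move=> y0 t St; rewrite ler_pdivrMr ?dotvv_gt0.
have [K _ SK] := form_upper_bound B.
have infS : has_inf S.
  by split; [exists K | exists (dotv x (B *m x) / dotv x x); exact: lbS].
pose m := inf S.
have mS : S m.
  move=> y; have [->|y0] := eqVneq y 0; first by rewrite mulmx0 !dotv0r mulr0.
  rewrite -ler_pdivrMr ?dotvv_gt0 //.
  by apply: lb_le_inf; [exists K | exact: lbS].
have qM y : dotv y ((m%:M - B) *m y) = m * dotv y y - dotv y (B *m y).
  by rewrite mulmxBl mul_scalar_mx !dotvlin.
have ml : m <= l.
  apply: Bl; rewrite -eigenvalue_root_char.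
  case: (boolP (eigenvalue B m)) => [//|/negP mB]; exfalso.
  have [|||c c0 hc] := @psd_unitmx_coercive (m%:M - B).
  - by rewrite linearB /= tr_scalar_mx Bsym.
  - rewrite unitmxE unitfE; apply/negP => /det0P[v v0 vM].
    apply: mB; apply/eigenvalueP; exists v => //; apply/esym/eqP.
    by rewrite -subr_eq0 -mul_mx_scalar -mulmxBr vM.
  - by move=> y; rewrite qM subr_ge0; apply: mS.
  have : S (m - c) by move=> y; have := hc y; rewrite qM; lra.
  move/(ge_inf infS.2); rewrite -/m; lra.
have := mS x; have := dotvv_gt0 x0; nra.
Qed.

(* [1 - A^2 = ((1 + A)(1 - A)(1 + A) + (1 - A)(1 + A)(1 - A)) / 2]. *)
Lemma symmetric_contraction A :
  A^T = A -> (forall x, x != 0 -> `|dotv x (A *m x)| < dotv x x) ->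
  exists2 c, 0 < c & forall x, dotv (A *m x) (A *m x) <= (1 - c) * dotv x x.
Proof.
move=> Asym Alt1.
have qM x : dotv x ((1%:M - A *m A) *m x) = dotv x x - dotv (A *m x) (A *m x).
  by rewrite mulmxBl mul1mx !dotvlin dotv_mulmxl Asym mulmxA.
have [||c c0 hc] := @posdef_coercive (1%:M - A *m A).
- by rewrite linearB /= trmx1 trmx_mul Asym.
- move=> x x0; rewrite qM.
  have E y z : dotv y (A *m z) = dotv (A *m y) z by rewrite dotv_mulmxl Asym.
  (* [hu] and [hw] say that the two products of the identity have positive form at [x]; they add up
     to the claim. *)
  have hu : x + A *m x != 0 ->
      dotv (A *m x) (A *m (A *m x)) + dotv (A *m x) (A *m x)
        < dotv x x + dotv x (A *m x).
    move=> /Alt1; rewrite ltr_norml => /andP[_].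
    rewrite !mulmxDr !dotvlin [dotv x (A *m (A *m x))]E (dotvC (A *m x) x); lra.
  have hw : x - A *m x != 0 ->
      dotv (A *m x) (A *m x) - dotv (A *m x) (A *m (A *m x))
        < dotv x x - dotv x (A *m x).
    move=> /Alt1; rewrite ltr_norml => /andP[+ _].
    rewrite !mulmxDr !mulmxN !dotvlin [dotv x (A *m (A *m x))]E.
    rewrite (dotvC (A *m x) x); lra.
  (* If one of the two vectors vanishes, [x] is an eigenvector for -1 or 1, and the other strict
     inequality is contradictory. *)
  have [u0|/hu] := eqVneq (x + A *m x) 0.
    have Ax : A *m x = - x by apply/eqP; rewrite -addr_eq0 addrC u0.
    have /hw : x - A *m x != 0.
      by rewrite Ax opprK -mulr2n -scaler_nat scaler_eq0 pnatr_eq0.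
    rewrite Ax mulmxN Ax !dotvlin; lra.
  have [w0|/hw] := eqVneq (x - A *m x) 0.
    have Ax : A *m x = x by apply/esym/eqP; rewrite -subr_eq0 w0.
    by rewrite !Ax; lra.
  lra.
exists c => // x; have := hc x; rewrite qM; lra.
Qed.

End Coercivity.

(** * The spectral norm as a supremum *)

(** The bound [r] makes the supremum genuine; normalizing [x] then carries it from the unit ball to
    all vectors. *)
Lemma specnorm_bounded (R : realType) m n (A : 'M[R]_(m, n)) (r : R) :
  0 <= r -> (forall x : 'cV[R]_n, norm2 (A *m x) <= r * norm2 x) ->
  0 <= specnorm A <= r /\
  forall x : 'cV[R]_n, norm2 (A *m x) <= specnorm A * norm2 x.
Proof.
move=> r0 Ar.
pose S := [set norm2 (A *m x) | x in [set x : 'cV[R]_n | norm2 x <= 1]]%classic.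
have norm2_0 k : norm2 (0 : 'cV[R]_k) = 0 by rewrite norm2E dotv0r sqrtr0.
have S0 : S 0 by exists 0; rewrite /= ?mulmx0 norm2_0 // ler01.
have ubS : ubound S r.
  by move=> _ [x /= x1 <-]; rewrite (le_trans (Ar x)) // ler_piMr.
have supS : has_sup S by split; [exists 0 | exists r].
split.
  apply/andP; split; first by have /ubP := sup_upper_bound supS; apply.
  by apply: ge_sup => //; exists 0.
move=> x; have [->|x0] := eqVneq x 0; first by rewrite mulmx0 !norm2_0 mulr0.
have nx0 : 0 < norm2 x.
  by rewrite lt_def norm2_ge0 andbT; apply: contra_neq x0; apply: norm2_eq0.
rewrite -ler_pdivrMr //; apply: (sup_upper_bound supS).
have nV : `|(norm2 x)^-1| = (norm2 x)^-1 by rewrite ger0_norm // invr_ge0 ltW.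
exists ((norm2 x)^-1 *: x); first by rewrite /= norm2Z nV mulVf ?gt_eqF.
by rewrite -scalemxAr norm2Z nV mulrC.
Qed.

(** * The graph Laplacian and its largest eigenvalue *)

Section Laplacian.
Variables (R : realType) (N : nat) (e : rel 'I_N).
Hypothesis esym : symmetric e.
Local Notation L := (laplacian R e).

Lemma laplacian_sym : L^T = L.
Proof.
rewrite /laplacian linearB /= tr_diag_mx; congr (_ - _).
by apply/matrixP => i j; rewrite !mxE esym.
Qed.

(** This is the Dirichlet energy; the factor one half compensates for counting each edge in both
    directions. *)
Lemma laplacian_form (x : 'cV[R]_N) :
  dotv x (L *m x) =
    2^-1 * \sum_i \sum_j (e i j)%:R * (x i ord0 - x j ord0) ^+ 2.
Proof.
have Lx i : (L *m x) i ord0 = \sum_j (e i j)%:R * (x i ord0 - x j ord0).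
  rewrite /laplacian /degree_mx mulmxBl mul_diag_mx !mxE -sum1_card natr_sum.
  rewrite mulr_suml big_mkcond -sumrB; apply: eq_bigr => j _.
  by rewrite !mxE inE mulrBr; case: (e i j); rewrite ?mul0r.
have E : dotv x (L *m x) =
    \sum_i \sum_j (e i j)%:R * (x i ord0 * (x i ord0 - x j ord0)).
  rewrite dotvE; apply: eq_bigr => i _; rewrite Lx mulr_sumr.
  by apply: eq_bigr => j _; rewrite mulrCA.
(* Swapping the indices gives a second expression of the form; adding it to [E] completes the
   squares. *)
have E' : dotv x (L *m x) =
    \sum_i \sum_j (e i j)%:R * (x j ord0 * (x j ord0 - x i ord0)).
  by rewrite E exchange_big; do 2!(apply: eq_bigr => ? _); rewrite esym.
suff <- : dotv x (L *m x) + dotv x (L *m x) =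
    \sum_i \sum_j (e i j)%:R * (x i ord0 - x j ord0) ^+ 2 by field.
rewrite {1}E E' -big_split; apply: eq_bigr => i _; rewrite -big_split /=.
by apply: eq_bigr => j _; ring.
Qed.

Lemma laplacian_psd (x : 'cV[R]_N) : 0 <= dotv x (L *m x).
Proof.
rewrite laplacian_form mulr_ge0 ?invr_ge0 // sumr_ge0 // => i _.
by rewrite sumr_ge0 // => j _; rewrite mulr_ge0 ?sqr_ge0.
Qed.

(** Zero energy forces equality across every edge, and paths propagate it. *)
Lemma laplacian_form_eq0 (x : 'cV[R]_N) :
  connected_graph e -> dotv x (L *m x) = 0 -> forall i j, x i ord0 = x j ord0.
Proof.
move=> econn /eqP; rewrite laplacian_form mulf_eq0 invr_eq0 pnatr_eq0 /=.
have ge0 i j : 0 <= (e i j)%:R * (x i ord0 - x j ord0) ^+ 2.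
  by rewrite mulr_ge0 ?sqr_ge0.
rewrite psumr_eq0 => [/allP x0|i _]; last by rewrite sumr_ge0.
have step i j : e i j -> x i ord0 = x j ord0.
  move=> eij; have := x0 i (mem_index_enum i); rewrite psumr_eq0 //=.
  move=> /allP/(_ j (mem_index_enum j)).
  by rewrite eij mul1r sqrf_eq0 subr_eq0 => /eqP.
move=> i j; have /connectP[s + ->] := econn i j.
by elim: s i => //= k s IHs i /andP[/step -> /IHs].
Qed.

End Laplacian.

Lemma ordered_spectrum_max (R : realType) n (A : 'M[R]_n) (lam : n.-tuple R) a :
  ordered_spectrum A lam -> root (char_poly A) a -> a <= lam`_n.-1.
Proof.
move=> [lam_sorted ->]; rewrite root_prod_XsubC => /(nthP 0)[i].
rewrite size_tuple => ilt <-.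
apply: sorted_leq_nth; rewrite ?inE ?size_tuple //.
- exact: le_trans.
(* Since [i < n], [n] is positive and [n.-1] is a true index, not one where [nth] returns its
   default. *)
- by rewrite prednK // (leq_ltn_trans _ ilt).
- by rewrite -ltnS prednK // (leq_ltn_trans _ ilt).
Qed.

(** * Stacked vectors, Kronecker products and block-diagonal matrices *)

Section BlockForms.
Variables (R : realType) (N d : nat).
Implicit Types (x : 'cV[R]_(N * d)).

(** Two slicings of a stack: a block-diagonal matrix acts agent by agent, [W *t 1%:M] coordinate by
    coordinate. *)
Definition agent x (i : 'I_N) : 'cV[R]_d := \col_k x (mxtens_index (i, k)) ord0.
Definition coordinate x (k : 'I_d) : 'cV[R]_N :=
  \col_i x (mxtens_index (i, k)) ord0.

Lemma sum_mxtens (F : 'I_(N * d) -> R) :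
  \sum_s F s = \sum_i \sum_k F (mxtens_index (i, k)).
Proof.
rewrite pair_bigA (reindex (@mxtens_index N d)) /=; last first.
  by exists (@mxtens_unindex N d) => s _; rewrite (mxtens_indexK, mxtens_unindexK).
by apply: eq_bigr => -[].
Qed.

Lemma dotv_agent x y : dotv x y = \sum_i dotv (agent x i) (agent y i).
Proof.
rewrite dotvE sum_mxtens; apply: eq_bigr => i _; rewrite dotvE.
by apply: eq_bigr => k _; rewrite !mxE.
Qed.

Lemma dotv_coordinate x y :
  dotv x y = \sum_k dotv (coordinate x k) (coordinate y k).
Proof.
rewrite dotvE sum_mxtens exchange_big; apply: eq_bigr => k _; rewrite dotvE.
by apply: eq_bigr => i _; rewrite !mxE.
Qed.

Lemma tens1_coordinate (W : 'M[R]_N) x k :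
  coordinate ((W *t 1%:M) *m x) k = W *m coordinate x k.
Proof.
apply/colP => i; rewrite !mxE sum_mxtens; apply: eq_bigr => j _.
rewrite (bigD1 k) //= big1 => [|l /negPf lk].
  by rewrite tensmxE !mxE eqxx mulr1 addr0.
by rewrite tensmxE !mxE eq_sym lk mulr0 mul0r.
Qed.

Lemma blkdiagE (B : 'I_N -> 'M[R]_d) i j k l :
  blkdiag B (mxtens_index (i, k)) (mxtens_index (j, l)) = B i k l *+ (i == j).
Proof.
(* Both numberings give [a * d + b]: [a] blocks of width [d] precede block [a]. *)
have idx (a : 'I_N) (b : 'I_d) :
    cast_ord (esym (blkdiag_dim N d)) (mxtens_index (a, b)) =
    @tagnat.rank N (fun=> d) (existT (fun=> 'I_d) a b).
  apply/ord_inj; rewrite tagnat.rankEsum /=.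
  by rewrite -(big_ord_widen N (fun=> d)) ?blkdiag_dim // ltnW.
rewrite /blkdiag castmxE !idx !mxE /tagnat.sig1 /tagnat.sig2 !tagnat.rankK /=.
(* [\mxdiag] inserts its blocks through [conform_mx], the identity here since all blocks have size
   [d]. *)
by case: eqP => _; rewrite ?mxE // conform_mx_id.
Qed.

Lemma blkdiag_agent (B : 'I_N -> 'M[R]_d) x i :
  agent (blkdiag B *m x) i = B i *m agent x i.
Proof.
apply/colP => k; rewrite !mxE sum_mxtens (bigD1 i) //= [X in _ + X]big1.
  by rewrite addr0; apply: eq_bigr => l _; rewrite blkdiagE eqxx !mxE.
move=> j /negPf ji; rewrite big1 // => l _.
by rewrite blkdiagE eq_sym ji mul0r.
Qed.

End BlockForms.

(** * The projections onto the coordinate blocks *)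

Section Selectors.
Variables (R : realType) (N : nat) (p : 'I_N -> nat).
Local Notation d := (\sum_(i < N) p i)%N.
Local Notation P := (selproj R p).

(** The selectors are the block columns of the identity, so this is the blockwise product of [1%:M]
    with its transpose. *)
Lemma selproj_sum : \sum_i P i = 1%:M.
Proof.
rewrite -[RHS]mul1mx -{2}(trmx1 R) -(submxrowK (1%:M : 'M[R]_d)) tr_mxrow.
by rewrite mul_mxrow_mxcol.
Qed.

Lemma selproj_sym i : (P i)^T = P i.
Proof. by rewrite trmx_mul trmxK. Qed.

Lemma selproj_psd i (v : 'cV[R]_d) : 0 <= dotv v (P i *m v).
Proof. by rewrite /selproj -mulmxA dotvC dotv_mulmxl dotvv_ge0. Qed.

Lemma selproj_form_sum (v : 'cV[R]_d) : \sum_i dotv v (P i *m v) = dotv v v.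
Proof. by rewrite -dotv_sumr -mulmx_suml selproj_sum mul1mx. Qed.

Lemma selproj_le i (v : 'cV[R]_d) : dotv v (P i *m v) <= dotv v v.
Proof.
rewrite -[leRHS]selproj_form_sum [leRHS](bigD1 i) //= lerDl sumr_ge0 // => j _.
exact: selproj_psd.
Qed.

End Selectors.

(** * Symmetry and strict form bound of the system matrix *)

Section Asys.
Variables (R : realType) (N : nat) (e : rel 'I_N) (p : 'I_N -> nat) (alpha : R).
Hypothesis esym : symmetric e.
Local Notation d := (\sum_(i < N) p i)%N.
Local Notation L := (laplacian R e).
Local Notation A := (A_sys e p alpha).

(** Kept bilinear, so that it yields both the symmetry and the form bound. *)
Lemma A_sys_dotv (x y : 'cV[R]_(N * d)) :
  dotv x (A *m y) =
    dotv x y - alpha * (\sum_k dotv (coordinate x k) (L *m coordinate y k))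
    - \sum_i dotv (agent x i) (selproj R p i *m agent y i).
Proof.
rewrite /A_sys mulmxBl !dotvlin; congr (_ - _); last first.
  by rewrite dotv_agent; apply: eq_bigr => i _; rewrite blkdiag_agent.
rewrite !dotv_coordinate mulr_sumr -sumrB; apply: eq_bigr => k _.
by rewrite tens1_coordinate mulmxBl mul1mx -scalemxAl !dotvlin.
Qed.

Lemma A_sys_sym : A^T = A.
Proof.
have E x y : dotv x (A *m y) = dotv x (A^T *m y).
  rewrite -dotv_mulmxl [RHS]dotvC !A_sys_dotv (dotvC y); congr (_ - _ * _ - _).
    apply: eq_bigr => k _.
    by rewrite [RHS]dotvC dotv_mulmxl laplacian_sym.
  apply: eq_bigr => i _.
  by rewrite [RHS]dotvC dotv_mulmxl selproj_sym.
(* By [E], the image of a basis vector under [A^T - A] is orthogonal to itself, so every column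
   vanishes. *)
apply/eqP; rewrite -subr_eq0; apply/eqP/matrixP => s t.
have : (A^T - A) *m delta_mx t (ord0 : 'I_1) = 0.
  by apply: dotvv_eq0; rewrite {2}mulmxBl !dotvlin E subrr.
by rewrite -colE => /matrixP/(_ s ord0); rewrite !mxE.
Qed.

(** The upper bound is [SLP]; the lower one holds since [alpha * SL < dotv x x] and
    [SP <= dotv x x]. *)
Lemma A_sys_form_lt (l : R) (x : 'cV[R]_(N * d)) :
  connected_graph e -> 0 < alpha -> alpha * l < 1 ->
  (forall y : 'cV[R]_N, dotv y (L *m y) <= l * dotv y y) ->
  x != 0 -> `|dotv x (A *m x)| < dotv x x.
Proof.
move=> econn alpha0 alphal Ll x0; have xx := dotvv_gt0 x0.
rewrite A_sys_dotv.
set SL := \sum_k dotv (coordinate x k) (L *m coordinate x k).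
set SP := \sum_i dotv (agent x i) (selproj R p i *m agent x i).
have SL0 : 0 <= SL by apply: sumr_ge0 => k _; apply: laplacian_psd.
have SLl : SL <= l * dotv x x.
  by rewrite dotv_coordinate mulr_sumr; apply: ler_sum => k _; apply: Ll.
have SP0 : 0 <= SP by apply: sumr_ge0 => i _; apply: selproj_psd.
have SP1 : SP <= dotv x x.
  by rewrite dotv_agent; apply: ler_sum => i _; apply: selproj_le.
have SLP : 0 < alpha * SL + SP.
  rewrite lt_def addr_ge0 ?mulr_ge0 ?(ltW alpha0) // andbT.
  apply: contra_neq x0 => /eqP; rewrite paddr_eq0 ?mulr_ge0 ?(ltW alpha0) //.
  rewrite mulf_eq0 gt_eqF //= psumr_eq0 => [|k _]; last exact: laplacian_psd.
  case/andP=> /allP SL_0; rewrite psumr_eq0 => [/allP SP_0|i _]; last first.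
    exact: selproj_psd.
  have cst i j : agent x i = agent x j.
    apply/colP => k; rewrite !mxE.
    have /eqP := SL_0 k (mem_index_enum k).
    by move/(laplacian_form_eq0 esym econn)/(_ i j); rewrite !mxE.
  apply/dotvv_eq0; rewrite dotv_agent big1 // => i _.
  (* As the agents agree, the term of [P_j] may be taken at agent [j], where it is a vanishing
     summand of [SP]. *)
  rewrite -selproj_form_sum big1 // => j _; rewrite (cst i j).
  by have /eqP := SP_0 j (mem_index_enum j).
rewrite ltr_norml; apply/andP; split; nra.
Qed.

End Asys.

Theorem lemma1 (R : realType) (N : nat) (hN : (2 <= N)%N)
    (e : rel 'I_N) (he : simple_graph e) (hconn : connected_graph e)
    (lam : N.-tuple R) (hlam : ordered_spectrum (laplacian R e) lam)
    (p : 'I_N -> nat)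
    (alpha : R) (halpha : 0 < alpha < 1 / lam`_N.-1) :
  let A := A_sys e p alpha in
  let sigma := specnorm A in
  specnorm A < 1 /\
  (0 <= sigma < 1 /\
   forall x : 'cV[R]_(N * (\sum_(i < N) p i)),
     norm2 (A *m x) <= sigma * norm2 x).
Proof.
have [esym _] := he; have /andP[alpha0 alphal] := halpha.
(* The bounds on [alpha] force [1 / lambda_N], hence [lambda_N], to be positive. *)
have l0 : 0 < lam`_N.-1 by have := lt_trans alpha0 alphal; rewrite div1r invr_gt0.
move=> A sigma; rewrite ltr_pdivlMr // in alphal.
have Ll := rayleigh_le (laplacian_sym R esym) (fun a => @ordered_spectrum_max _ _ _ _ a hlam).
have [c c0 Ac] := symmetric_contraction (A_sys_sym p alpha esym)
  (fun x => @A_sys_form_lt _ _ _ p _ esym _ x hconn alpha0 alphal Ll).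
have r1 : Num.sqrt (1 - c) < 1 by rewrite -[ltRHS]sqrtr1 ltr_sqrt //; lra.
have [x|/andP[sigma0 sigmar] Asigma] := @specnorm_bounded _ _ _ A _ (sqrtr_ge0 (1 - c)).
  (* [sqrtrM] wants a nonnegative first factor: [dotv x x] is one, whereas the sign of [1 - c] is
     not known. *)
  rewrite !norm2E [leRHS]mulrC -sqrtrM ?dotvv_ge0 // mulrC.
  exact/ler_wsqrtr/Ac.
by have sigma1 := le_lt_trans sigmar r1; rewrite sigma0 sigma1.
Qed.
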